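(* Let $N\in\mathbb N$ (the security parameter) and let $q,\tau,r$ be constants, where $q,\tau>0$ are small and $r<1$ is close to $1$. For any $\delta>0$, the bit-commitment scheme $\textsc{commit}^{\mathsf{1CC}}_{N,q,\tau,r}$ (with its reveal phase) described in the context is $\epsilon$-universally extractable with $$\epsilon\le 2^{-N(1-2q)(\tau/2-2h(\delta))}+\sqrt{4\exp(-q^2\delta^2N/8)}.$$
   Context: Notation: $h(\delta)=-\delta\log_2\delta-(1-\delta)\log_2(1-\delta)$ is the binary entropy function. For $b\in\{0,1\}$, $|b\rangle_0$ is the computational basis vector $|b\rangle$ and $|b\rangle_1$ the diagonal basis vector, $|0\rangle_1=\frac1{\sqrt2}(|0\rangle+|1\rangle)$, $|1\rangle_1=\frac1{\sqrt2}(|0\rangle-|1\rangle)$; for $x,\theta\in\{0,1\}^n$, $|x\rangle_\theta=\bigotimes_i|x_i\rangle_{\theta_i}$. For $u\subseteq[n]$, $x_u$ is the substring of $x$ indexed by $u$. A family $\mathcal G_n$ of functions $\{0,1\}^n\to\{0,1\}$ is two-universal if $\Pr_{g\in_R\mathcal G_n}[g(x)=g(y)]\le\frac12$ for all $x\ne y$. The syndrome of $v\in\{0,1\}^n$ for a binary linear $[n,k,d]$ code ($d$ = minimum distance) is $Hv\in\{0,1\}^{n-k}$, for a fixed $(n-k)\times n$ parity check matrix $H$ of the code. The ideal functionality $\mathsf{1CC}$ (one-bit cut-and-choose): one player inputs a bit $x$, the other player inputs $c\in\{0,1\}$; the first player receives $c$, and the second receives $\bot$ if $c=0$ and $x$ if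 $c=1$. Commit phase, committer Alice (with bit $b$), receiver Bob. (1) Alice chooses random $\theta\in\{0,1\}^N$ and sends the $N$-qubit state $|0^N\rangle_\theta$ to Bob. (2) For $i=1,\dots,N$: Alice and Bob invoke $\mathsf{1CC}$, Alice inputting $\theta_i$ and Bob inputting $1$ with probability $q$ and $0$ with probability $1-q$; if Bob's input was $1$ he measures the $i$th qubit in basis $\theta_i$ and aborts if the result is not $0$. Let $t\subseteq[N]$ be the set of positions checked by Bob, $\bar t=[N]\setminus t$, $n=|\bar t|$. (3) Alice aborts if Bob checked more than $2qN$ positions. (4) Bob chooses a generator matrix $G$ of an $[n,k,d]$ code with $k/n\ge r$ and $d/n\ge\tau$ and sends $G$ to Alice, who checks that $k/n\ge r$. (5) Alice picks a random $g$ from a two-universal family $\mathcal G_n$ of functions $\{0,1\}^n\to\{0,1\}$, computes the syndrome $s$ of $\theta_{\bar t}$, and sends $g$, $s$, $w=g(\theta_{\bar t})\oplus b$ to Bob. Reveal phase. Alice sends $\theta_{\bar t}$ and $b$ to Bob. Bob measures the $i$th qubit in basis $\theta_i$ for all $i\in\bar t$ and checks that all outcomes are $0$, that $\theta_{\bar t}$ has syndrome $s$, and that $g(\theta_{\bar t})\oplus w=b$; he aborts if any check fails. Universal extractability: the scheme is $\epsilon$-universally extractable if there exists a (bit-valued) function $c$ acting on the classical information held by Bob and by $\mathsf{1CC}$ after the commit phase (including the bits that Alice input to $\mathsf{1CC}$), such that for any pure commit and open strategy of a dishonest Alice, she has probability at most $\epsilon$ of successfully unveiling the bit $1-c$, where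 $c$ is evaluated on that classical information.
   Formalization: The claim is proved for 0 < δ ≤ 1/2 rather than any δ > 0 (h(δ) is undefined for δ > 1, and the bound fails for δ near 1, e.g. q = 0.2, τ = 0.001), and ''q small'' is read as 0 < q ≤ 1/2. *)

(* Defs.v *)
From mathcomp Require Import all_boot all_order all_algebra.
From mathcomp Require Import complex.
From mathcomp Require Import reals sequences exp.

Set Implicit Arguments.
Unset Strict Implicit.
Unset Printing Implicit Defensive.

Import Order.TTheory GRing.Theory Num.Theory.
Local Open Scope ring_scope.

Definition log2 (R : realType) (x : R) : R := ln x / ln 2.

Definition entropy (R : realType) (delta : R) : R :=
  - delta * log2 delta - (1 - delta) * log2 (1 - delta).

(* Bits are elements of 'F_2, so xor is [+] and the complement of [b] is
   [1 - b]; bit strings are row vectors. *)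

Definition hamming n (x y : 'rV['F_2]_n) : nat := #|[set i | x 0 i != y 0 i]|.

(* The dimension [tag G : 'I_n.+1] comes with the k x n matrix [tagged G]. *)
Definition generator n : finType := {k : 'I_n.+1 & 'M['F_2]_(k, n)}.

Definition codeword n (G : generator n) (v : 'rV['F_2]_n) : bool :=
  (v <= tagged G)%MS.

(* Distances are at most n, so the default value n only matters for the zero
   code, which has no pair of distinct codewords. *)
Definition min_distance n (G : generator n) : nat :=
  \big[minn/n]_(p : 'rV['F_2]_n * 'rV['F_2]_n
      | [&& codeword G p.1, codeword G p.2 & p.1 != p.2]) hamming p.1 p.2.

(* k/n >= r and d/n >= tau, multiplied out so that they make sense for n = 0
   (which occurs when all the positions have been checked). *)
Definition good_code (R : realType) (tau r : R) n (G : generator n) : bool :=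
  [&& row_free (tagged G),
      r * n%:R <= (tag G)%:R & tau * n%:R <= (min_distance G)%:R].

Definition syndrome n k (H : 'M['F_2]_(k, n)) (v : 'rV['F_2]_n) : 'rV['F_2]_k :=
  v *m H^T.

Definition parity_check n (G : generator n) (H : 'M['F_2]_(n - tag G, n)) :=
  forall v, codeword G v = (syndrome H v == 0).

(* [I] indexes the family, so that repetitions are allowed. *)
Definition two_universal n (I : finType) (f : I -> 'rV['F_2]_n -> 'F_2) : Prop :=
  (0 < #|I|)%N /\
  forall x y, x != y -> (2 * #|[set g | f g x == f g y]| <= #|I|)%N.

(* The outputs of the one-bit cut-and-choose: to the player who inputs the bit
   x, and to the player who inputs the choice c. *)
Definition onecc (x : 'F_2) (c : bool) : bool * option 'F_2 :=
  (c, if c then Some x else None).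

Definition bob_view N (x : 'rV['F_2]_N) (t : {set 'I_N}) :
    {ffun 'I_N -> option 'F_2} :=
  [ffun i => (onecc (x 0 i) (i \in t)).2].

(* [choose t v] is the distribution of the code chosen by (honest) Bob when he
   checked the positions in t and obtained v from the invocations of onecc. *)
Record scheme (R : realType) (N : nat) (tau r : R) := Scheme {
  parity : forall n (G : generator n), 'M['F_2]_(n - tag G, n);
  parityP : forall n (G : generator n),
    row_free (tagged G) -> parity_check (parity G);
  family : nat -> finType;
  hash : forall n, family n -> 'rV['F_2]_n -> 'F_2;
  hashP : forall n, two_universal (@hash n);
  choose : forall t : {set 'I_N},
    {ffun 'I_N -> option 'F_2} -> generator #|~: t| -> R;
  choose_ge0 : forall t v G, 0 <= @choose t v G;
  choose_sum1 : forall t v, \sum_G @choose t v G = 1;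
  choose_good : forall t v G, 0 < @choose t v G -> good_code tau r G
}.

(* The classical information held by Bob and by the onecc functionality after
   the commit phase. *)
Record info (R : realType) (N : nat) (tau r : R) (S : scheme N tau r) := Info {
  inputs : 'rV['F_2]_N;
  checked : {set 'I_N};
  code : generator #|~: checked|;
  fct : family S #|~: checked|;
  synd : 'rV['F_2]_(#|~: checked| - tag code);
  masked : 'F_2
}.

(* A vector of A (x) (C^2)^{(x) N}, where A = C^m is the register of the
   committer, is represented by the vectors psi z of A such that it is the sum
   of the psi z (x) |z>, where |z> ranges over the computational basis. *)

Definition joint (R : realType) (m N : nat) :=
  {ffun 'rV['F_2]_N -> 'cV[R[i]]_m}.

Definition sqnorm (R : realType) m N (psi : joint R m N) : R :=
  \sum_(z : 'rV['F_2]_N) \sum_(a < m) Normc.normc (psi z a 0) ^+ 2.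

(* |b>_theta *)
Definition ket (R : realType) (b theta : 'F_2) : 'cV[R[i]]_2 :=
  let e (c : 'F_2) : 'cV[R[i]]_2 := delta_mx c 0 in
  if theta == 0 then e b
  else (sqrtC 2)^-1 *: (if b == 0 then e 0 + e 1 else e 0 - e 1).

Definition adj (R : realType) m n (M : 'M[R[i]]_(m, n)) : 'M[R[i]]_(n, m) :=
  map_mx Num.conj M^T.

Definition act (R : realType) m N (K : 'M[R[i]]_m) (psi : joint R m N) :
    joint R m N :=
  [ffun z : 'rV['F_2]_N => K *m psi z].

Definition update N (z : 'rV['F_2]_N) (i : 'I_N) (b : 'F_2) : 'rV['F_2]_N :=
  \row_j (if j == i then b else z 0 j).

(* The unnormalized state after measuring qubit i in basis theta with outcome
   0: the projector |0>_theta <0|_theta is applied to qubit i. *)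
Definition measure0 (R : realType) m N (i : 'I_N) (theta : 'F_2)
    (psi : joint R m N) : joint R m N :=
  let P := ket R 0 theta *m adj (ket R 0 theta) in
  [ffun z : 'rV['F_2]_N => \sum_(b : 'F_2) P (z 0 i) b *: psi (update z i b)].

(* A measurement with one Kraus operator per outcome: it maps pure states to
   pure states, conditionally on the outcome. *)
Definition instrument (R : realType) m (O : finType) (K : O -> 'M[R[i]]_m) :=
  \sum_o adj (K o) *m K o = 1%:M.

(* [in_op h] yields the next input to onecc, where h lists the earlier rounds as
   pairs of the input and of the bit returned by onecc; [com_op] yields the
   message (g, s, w), and [open_op] the announced string and bit.  The committer
   is not bound to abort when many positions are checked. *)
Record strategy (R : realType) N (tau r : R) (S : scheme N tau r) := Strategy {
  adim : nat;
  init : joint R adim N;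
  in_op : seq ('F_2 * bool) -> 'F_2 -> 'M[R[i]]_adim;
  com_op : forall (x : 'rV['F_2]_N) (t : {set 'I_N}) (G : generator #|~: t|),
    family S #|~: t| * 'rV['F_2]_(#|~: t| - tag G) * 'F_2 -> 'M[R[i]]_adim;
  open_op : forall I : info S,
    'rV['F_2]_#|~: checked I| * 'F_2 -> 'M[R[i]]_adim;
  init_unit : sqnorm init = 1;
  in_opP : forall h, instrument (in_op h);
  com_opP : forall x t G, instrument (@com_op x t G);
  open_opP : forall I, instrument (@open_op I)
}.

Section Run.
Variables (R : realType) (N : nat) (tau r : R) (S : scheme N tau r).
Variable A : strategy S.

Definition history (x : 'rV['F_2]_N) (t : {set 'I_N}) (i : 'I_N) :
    seq ('F_2 * bool) :=
  [seq (x 0 j, (onecc (x 0 j) (j \in t)).1) | j : 'I_N <- enum 'I_N & (j < i)%N].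

Definition round x t (psi : joint R (adim A) N) (i : 'I_N) :=
  let psi' := act (in_op A (history x t i) (x 0 i)) psi in
  if bob_view x t i is Some theta then measure0 i theta psi' else psi'.

Definition after_checks x t : joint R (adim A) N :=
  foldl (round x t) (init A) (enum 'I_N).

Definition after_commit (I : info S) : joint R (adim A) N :=
  act (@com_op _ _ _ _ _ A (inputs I) (checked I) (code I)
         (fct I, synd I, masked I))
      (after_checks (inputs I) (checked I)).

(* [enum_val j] is the j-th unchecked position. *)
Definition after_reveal (I : info S) (y : 'rV['F_2]_#|~: checked I|) (b : 'F_2) :
    joint R (adim A) N :=
  foldl (fun psi (j : 'I_#|~: checked I|) => measure0 (enum_val j) (y 0 j) psi)
    (act (@open_op _ _ _ _ _ A I (y, b)) (after_commit I)) (enum 'I_#|~: checked I|).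

Definition accepts (I : info S) (y : 'rV['F_2]_#|~: checked I|) (b : 'F_2) :=
  (syndrome (parity S (code I)) y == synd I) &&
  (hash (fct I) y + masked I == b).

(* All quantum states above are unnormalized, so that the squared norm is the
   probability of the outcomes of both players (and of no abort of Bob) for
   given random choices of Bob. *)
Definition prob_unveil_opposite (q : R) (c : info S -> 'F_2) : R :=
  \sum_(x : 'rV['F_2]_N) \sum_(t : {set 'I_N})
    (\prod_i (if i \in t then q else 1 - q)) *
    \sum_(G : generator #|~: t|) choose S (bob_view x t) G *
      \sum_(g : family S #|~: t|) \sum_(s : 'rV['F_2]_(#|~: t| - tag G))
      \sum_(w : 'F_2) let I := @Info _ _ _ _ S x t G g s w in
        \sum_(y : 'rV['F_2]_#|~: t|) \sum_(b : 'F_2 |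
            accepts (I := I) y b && (b == 1 - c I))
          sqnorm (after_reveal (I := I) y b).

End Run.

Definition universally_extractable (R : realType) (N : nat) (q tau r : R)
    (S : scheme N tau r) (eps : R) : Prop :=
  exists c : info S -> 'F_2,
    forall A : strategy S, prob_unveil_opposite A q c <= eps.

(* Main.v *)
Require Import Defs.
From mathcomp Require Import all_boot all_order all_algebra.
From mathcomp Require Import zify ring lra.
From mathcomp Require Import complex.
From mathcomp Require Import reals sequences exp.

(** The qubits sent by the committer are expanded in the basis given by the
bits x that she inputs to 1CC. All her operations act on her own register,
hence commute with the receiver's measurements, and unveiling y amounts to
projecting the qubits on |0>_th, where th is x at the checked positions t and
y elsewhere.

The bit c is computed from the only string with the announced syndrome at
distance less than d/2 from the unchecked part of x. To unveil 1 - c, the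
committer has to announce some y at distance at least d/2, so that |0>_th has
squared overlap at most 2^(-d/2) with every basis vector |z>_x. A component z
survives the checks only if z vanishes on t. By the Cauchy-Schwarz inequality,
the light components (z of weight at most delta n) contribute at most
2^(-n(tau/2 - h(delta))), and averaging over t turns n into N(1-2q) without any
tail bound on the number of checked positions. The heavy components have total
mass at most exp(-q^2 delta^2 N/4) by an exponential supermartingale over the
rounds, which copes with inputs x_i chosen adaptively. *)

Set Implicit Arguments.
Unset Strict Implicit.
Unset Printing Implicit Defensive.

Import Order.TTheory GRing.Theory Num.Theory.
Local Open Scope ring_scope.

(** * Bits, squared norms and the weighted Cauchy-Schwarz inequality *)

Lemma F2_cases (a : 'F_2) : {a = 0} + {a = 1}.
Proof. by case: a => -[|[|//]] lt2; [left|right]; apply: val_inj. Qed.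

Lemma sum_F2 (V : nmodType) (f : 'F_2 -> V) : \sum_a f a = f 0 + f 1.
Proof.
rewrite big_ord_recl big_ord1; congr (f _ + f _); exact: val_inj.
Qed.

Section Norm.
Variable R : realType.
Local Notation C := R[i].
Local Notation normc := (@Normc.normc R).

Lemma normc_sqr_conj (z : C) : (normc z ^+ 2)%:C%C = z * Num.conj z.
Proof. by rewrite rmorphXn /= -normCK. Qed.

Lemma normc_zero : normc 0 = 0 :> R.
Proof. exact: Normc.normc0. Qed.

Lemma normc_ge0 (z : C) : 0 <= normc z.
Proof. by case: z => a b; rewrite sqrtr_ge0. Qed.

Definition nsq m (v : 'cV[C]_m) : R := \sum_(a < m) normc (v a 0) ^+ 2.

Lemma nsq_ge0 m (v : 'cV[C]_m) : 0 <= nsq v.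
Proof. by apply: sumr_ge0 => a _; apply: sqr_ge0. Qed.

Lemma nsq0 m : nsq (0 : 'cV[C]_m) = 0.
Proof. by apply: big1 => a _; rewrite mxE normc_zero expr0n. Qed.

Lemma sqnormE m N (psi : joint R m N) : sqnorm psi = \sum_z nsq (psi z).
Proof. by []. Qed.

Lemma adj_mulmx_self m (v : 'cV[C]_m) : (adj v *m v) 0 0 = (nsq v)%:C%C.
Proof.
rewrite mxE rmorph_sum; apply: eq_bigr => a _.
by rewrite !mxE /= normc_sqr_conj mulrC.
Qed.

Lemma adjM m n p (A : 'M[C]_(m, n)) (B : 'M[C]_(n, p)) :
  adj (A *m B) = adj B *m adj A.
Proof. by rewrite /adj trmx_mul map_mxM. Qed.

Lemma instrument_nsq m (O : finType) (K : O -> 'M[C]_m) (v : 'cV[C]_m) :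
  instrument K -> \sum_o nsq (K o *m v) = nsq v.
Proof.
move=> instrK; apply: (@complexI R); rewrite rmorph_sum /=.
transitivity ((adj v *m (\sum_o adj (K o) *m K o) *m v) 0 0).
  rewrite mulmx_sumr mulmx_suml summxE; apply: eq_bigr => o _.
  by rewrite -adj_mulmx_self adjM !mulmxA.
by rewrite instrK mulmx1 adj_mulmx_self.
Qed.

Lemma instrument_sqnorm m N (O : finType) (K : O -> 'M[C]_m)
    (psi : joint R m N) :
  instrument K -> \sum_o sqnorm (act (K o) psi) = sqnorm psi.
Proof.
move=> instrK; rewrite exchange_big /=; apply: eq_bigr => z _.
rewrite -[RHS](@instrument_nsq _ _ K) //; apply: eq_bigr => o _.
by rewrite ffunE.
Qed.

(* Weighted Cauchy-Schwarz; the second hypothesis is there because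
   [x / 0 = 0]. *)
Lemma nsq_sum_le m (I : finType) (c : I -> C) (v : I -> 'cV[C]_m)
    (om : I -> R) :
  (forall i, 0 <= om i) -> (forall i, om i = 0 -> c i = 0) ->
  \sum_i normc (c i) ^+ 2 / om i <= 1 ->
  nsq (\sum_i c i *: v i) <= \sum_i om i * nsq (v i).
Proof.
move=> om_ge0 om0 c_le1.
have -> : \sum_i om i * nsq (v i) =
    \sum_(a < m) \sum_i om i * normc (v i a 0) ^+ 2.
  by rewrite exchange_big /=; apply: eq_bigr => i _; rewrite mulr_sumr.
apply: ler_sum => a _.
set s := \sum_i normc (c i) * normc (v i a 0).
have norm_le : normc ((\sum_i c i *: v i) a 0) <= s.
  rewrite summxE /s; elim/big_ind2: _ => [|x x' y y' le_x le_y|i _].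
  - by rewrite normc_zero.
  - by apply: le_trans (le_normcD _ _) _; apply: lerD.
  - by rewrite mxE Normc.normcM.
have s_ge0 : 0 <= s by apply: sumr_ge0 => i _; rewrite mulr_ge0 ?normc_ge0.
suff: s ^+ 2 <= \sum_i om i * normc (v i a 0) ^+ 2.
  by apply: le_trans; rewrite ler_sqr ?nnegrE ?normc_ge0.
(* AM-GM on each term of [2 s^2] *)
have : \sum_i 2 * s * (normc (c i) * normc (v i a 0)) <=
    \sum_i (s ^+ 2 * (normc (c i) ^+ 2 / om i) + om i * normc (v i a 0) ^+ 2).
  apply: ler_sum => i _; have [om_i0|om_i_neq0] := eqVneq (om i) 0.
    by rewrite om_i0 om0 // normc_zero !(mul0r, mulr0, expr0n, addr0).
  have om_gt0 : 0 < om i by rewrite lt_def om_i_neq0 om_ge0.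
  rewrite -subr_ge0 -(pmulr_rge0 _ om_gt0).
  have -> : om i * (s ^+ 2 * (normc (c i) ^+ 2 / om i) +
      om i * normc (v i a 0) ^+ 2 - 2 * s * (normc (c i) * normc (v i a 0))) =
      (s * normc (c i) - om i * normc (v i a 0)) ^+ 2 by field.
  exact: sqr_ge0.
rewrite big_split -!mulr_sumr -/s /=.
have := ler_wpM2l (sqr_ge0 s) c_le1; rewrite mulr1; nra.
Qed.

End Norm.

(** * The two bases of a qubit and the overlaps between them *)

Section Ket.
Variable R : realType.
Local Notation C := R[i].
Local Notation normc := (@Normc.normc R).

Definition ketc (b th c : 'F_2) : C := ket R b th c 0.

Lemma ketcE b th c : ketc b th c =
  if th == 0 then (c == b)%:R
  else (sqrtC 2)^-1 * (if (b == 1) && (c == 1) then -1 else 1).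
Proof.
rewrite /ketc /ket; case: (F2_cases th) => ->; rewrite /= !mxE ?andbT //.
by case: (F2_cases b) => ->; case: (F2_cases c) => ->; rewrite /= !mxE /=;
   congr (_ * _); rewrite ?subr0 ?sub0r ?addr0 ?add0r.
Qed.

Lemma sqrtC2V : (sqrtC 2)^-1 * (sqrtC 2)^-1 = 2^-1 :> C.
Proof. by rewrite -invfM -expr2 sqrtCK. Qed.

Lemma conj_sqrtC2V : Num.conj (sqrtC 2)^-1 = (sqrtC 2)^-1 :> C.
Proof. by apply/CrealP; rewrite ger0_real // invr_ge0 sqrtC_ge0. Qed.

Lemma conj_ketc b th c : Num.conj (ketc b th c) = ketc b th c.
Proof.
rewrite ketcE; case: ifP => _; first by rewrite rmorph_nat.
by rewrite rmorphM /= conj_sqrtC2V; case: ifP; rewrite ?rmorphN rmorph1.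
Qed.

(** In either basis the entries form the identity or the Hadamard matrix, both symmetric. Hence
    [ketc_orth] also serves as a completeness relation. *)
Lemma ketc_sym b th c : ketc b th c = ketc c th b.
Proof. by rewrite !ketcE (eq_sym c b) (andbC (b == 1)). Qed.

Lemma ketc_orth b b' th : \sum_c ketc b th c * ketc b' th c = (b == b')%:R.
Proof.
have half2 : 2^-1 + 2^-1 = 1 :> C by field.
rewrite sum_F2 !ketcE.
by case: (F2_cases th) => ->; case: (F2_cases b) => ->;
  case: (F2_cases b') => ->; rewrite /= ?(mulr1, mulr0, mulrN, mulNr, opprK,
     addr0, add0r, mul0r, subrr, sqrtC2V, addNr).
Qed.

(** The inner product of |0>_y with |b>_x; no conjugation appears because the entries are real
    ([conj_ketc]). *)
Definition overlap (y x b : 'F_2) : C := \sum_c ketc 0 y c * ketc b x c.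

Lemma overlap_same x b : overlap x x b = (b == 0)%:R.
Proof. by rewrite /overlap ketc_orth eq_sym. Qed.

Lemma ketc_overlap y x c : ketc 0 y c = \sum_b overlap y x b * ketc b x c.
Proof.
rewrite /overlap; under eq_bigr do rewrite mulr_suml.
rewrite exchange_big /=.
under eq_bigr => a _.
  under eq_bigr => b _ do rewrite -mulrA (ketc_sym b x a) (ketc_sym b x c).
  rewrite -mulr_sumr ketc_orth.
over.
by rewrite (bigD1 c) //= eqxx mulr1 big1 ?addr0 // => a /negPf->; rewrite mulr0.
Qed.

(** The computational and diagonal bases are mutually unbiased. *)
Lemma overlap_neq y x b : y != x -> normc (overlap y x b) ^+ 2 = 2^-1.
Proof.
have s2 : normc (sqrtC 2)^-1 ^+ 2 = 2^-1 :> R.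
  apply: (@complexI R); rewrite normc_sqr_conj.
  by rewrite conj_sqrtC2V sqrtC2V fmorphV rmorph_nat.
rewrite /overlap sum_F2 !ketcE.
by case: (F2_cases y) => ->; case: (F2_cases x) => ->; case: (F2_cases b) => ->;
  rewrite ?eqxx //= => _;
  rewrite ?(mulr1, mul1r, mulr0, addr0, add0r, mul0r, mulrN) ?normcN.
Qed.

Lemma sum_overlap y x : \sum_b normc (overlap y x b) ^+ 2 = 1.
Proof.
have [->|neq_yx] := eqVneq y x; last first.
  by rewrite sum_F2 !overlap_neq //; lra.
by rewrite sum_F2 !overlap_same eqxx oner_eq0 normc_zero Normc.normc1 expr1n
  expr0n addr0.
Qed.

Lemma ket_sqnorm m (th : 'F_2) (f : 'F_2 -> 'cV[C]_m) :
  \sum_b nsq (\sum_c ketc b th c *: f c) = \sum_c nsq (f c).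
Proof.
rewrite /nsq exchange_big [RHS]exchange_big /=; apply: eq_bigr => a _.
(* A unitary change of basis is a measurement with a single outcome, so [instrument_nsq] gives the
   invariance of the norm. *)
pose K (_ : unit) : 'M[C]_2 := \matrix_(b, c) ketc b th c.
pose v : 'cV[C]_2 := \col_c f c a 0.
have instrK : instrument K.
  rewrite /instrument (bigD1 tt) //= big1 ?addr0; last by case.
  apply/matrixP => i j; rewrite !mxE -(ketc_orth _ _ th); apply: eq_bigr => c _.
  by rewrite !mxE conj_ketc ketc_sym (ketc_sym c).
have := @instrument_nsq R _ _ K v instrK.
rewrite (bigD1 tt) //= big1 ?addr0; last by case.
rewrite /nsq => nsqK.
transitivity (\sum_(b < 2) normc ((K tt *m v) b 0) ^+ 2); last first.
  by rewrite nsqK; apply: eq_bigr => c _; rewrite mxE.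
apply: eq_bigr => b _; congr (normc _ ^+ 2).
by rewrite summxE mxE; apply: eq_bigr => c _; rewrite !mxE.
Qed.

End Ket.


(** * Sums over row vectors *)

Section Rows.
Variable T : finType.

(** Putting the new entry in front makes inductions on the number of qubits follow the order of the
    rounds. *)
Definition consr N (a : T) (x : 'rV[T]_N) : 'rV[T]_N.+1 :=
  \row_i (if unlift ord0 i is Some j then x 0 j else a).

Lemma consr0 N a (x : 'rV[T]_N) : consr a x 0 ord0 = a.
Proof. by rewrite mxE unlift_none. Qed.

Lemma consrS N a (x : 'rV[T]_N) i : consr a x 0 (lift ord0 i) = x 0 i.
Proof. by rewrite mxE liftK. Qed.

Lemma sum_consr (V : nmodType) N (f : 'rV[T]_N.+1 -> V) :
  \sum_x f x = \sum_a \sum_(x : 'rV[T]_N) f (consr a x).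
Proof.
rewrite pair_big /=.
rewrite (reindex (fun p : T * 'rV[T]_N => consr p.1 p.2)) //=.
exists (fun x : 'rV[T]_N.+1 => (x 0 ord0, \row_i x 0 (lift ord0 i))).
  move=> [a x] _ /=; rewrite consr0; congr pair.
  by apply/rowP => i; rewrite mxE consrS.
move=> x _ /=; apply/rowP => i; rewrite mxE.
by case: unliftP => [j ->|->] /=; rewrite ?mxE.
Qed.

Lemma prod_sum_row (P : comPzSemiRingType) N (F : 'I_N -> T -> P) :
  \prod_i \sum_a F i a = \sum_(z : 'rV[T]_N) \prod_i F i (z 0 i).
Proof.
rewrite bigA_distr_bigA /=.
rewrite (reindex (fun z : 'rV[T]_N => [ffun i => z 0 i])) /=.
  by apply: eq_bigr => z _; apply: eq_bigr => i _; rewrite ffunE.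
exists (fun f : {ffun 'I_N -> T} => \row_i f i) => [z|f] _.
  by apply/rowP => i; rewrite mxE ffunE.
by apply/ffunP => i; rewrite ffunE mxE.
Qed.

End Rows.

(** * Coefficients of a joint state in a product basis *)

Section Coef.
Variables (R : realType) (m : nat).
Local Notation C := R[i].

(* The coefficient of |z>_th; the entries of [ket] are real, so that no
   conjugation is needed. *)
Definition coef N (th z : 'rV['F_2]_N) (psi : joint R m N) : 'cV[C]_m :=
  \sum_(u : 'rV['F_2]_N) (\prod_i ketc R (z 0 i) (th 0 i) (u 0 i)) *: psi u.

Lemma coef_act N th z (K : 'M[C]_m) (psi : joint R m N) :
  coef th z (act K psi) = K *m coef th z psi.
Proof.
rewrite mulmx_sumr; apply: eq_bigr => u _; by rewrite ffunE scalemxAr.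
Qed.

(** The one-qubit completeness relation [ketc_overlap] is applied at every position and the product
    of sums is expanded. This expresses the unveiled basis [y] in the basis [x] of the inputs. *)
Lemma coef_change N (y x : 'rV['F_2]_N) (psi : joint R m N) :
  coef y 0 psi =
    \sum_(z : 'rV['F_2]_N) (\prod_i overlap R (y 0 i) (x 0 i) (z 0 i)) *:
      coef x z psi.
Proof.
under [RHS]eq_bigr do rewrite scaler_sumr.
rewrite exchange_big /=; apply: eq_bigr => u _.
under [RHS]eq_bigr do rewrite scalerA -big_split /=.
rewrite -scaler_suml; congr (_ *: _).
rewrite -(prod_sum_row (fun i b => overlap R (y 0 i) (x 0 i) b *
  ketc R b (x 0 i) (u 0 i))); apply: eq_bigr => i _.
by rewrite mxE (ketc_overlap _ _ (x 0 i)).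
Qed.

(** The unnormalized state of the register and the other qubits once the first qubit is projected on
    |b>_th. *)
Definition part N (th b : 'F_2) (psi : joint R m N.+1) : joint R m N :=
  [ffun u => \sum_c ketc R b th c *: psi (consr c u)].

Lemma coef_consr N a b (x z : 'rV['F_2]_N) (psi : joint R m N.+1) :
  coef (consr a x) (consr b z) psi = coef x z (part a b psi).
Proof.
rewrite /coef sum_consr exchange_big /=; apply: eq_bigr => u _.
rewrite ffunE scaler_sumr; apply: eq_bigr => c _.
rewrite big_ord_recl !consr0 scalerA mulrC; congr (_ * _ *: _).
by apply: eq_bigr => i _; rewrite !consrS.
Qed.

Lemma act_part N (K : 'M[C]_m) th b (psi : joint R m N.+1) :
  act K (part th b psi) = part th b (act K psi).
Proof.
apply/ffunP => u; rewrite !ffunE mulmx_sumr; apply: eq_bigr => c _.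
by rewrite ffunE scalemxAr.
Qed.

Lemma sqnorm_part N th (psi : joint R m N.+1) :
  \sum_b sqnorm (part th b psi) = sqnorm psi.
Proof.
rewrite exchange_big [RHS]sum_consr [RHS]exchange_big /=; apply: eq_bigr => u _.
rewrite -[RHS](ket_sqnorm th (fun c => psi (consr c u))).
by apply: eq_bigr => b _; rewrite ffunE.
Qed.

(** Parseval's identity, obtained by peeling off one qubit at a time with [sqnorm_part]. *)
Lemma sqnorm_coef N th (psi : joint R m N) :
  \sum_z nsq (coef th z psi) = sqnorm psi.
Proof.
elim: N th psi => [|N IHN] th psi.
  rewrite sqnormE; apply: eq_bigr => z _.
  rewrite /coef (bigD1 z) //= big_ord0 scale1r big1 ?addr0 // => u /negP[].
  by apply/eqP/rowP; case.
have -> : th = consr (th 0 0) (\row_i th 0 (lift ord0 i)).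
  by apply/rowP => i; rewrite mxE; case: unliftP => [j ->|->]; rewrite ?mxE.
rewrite sum_consr -[RHS](sqnorm_part (th 0 0)); apply: eq_bigr => b _.
rewrite -(IHN (\row_i th 0 (lift ord0 i))).
by apply: eq_bigr => z _; rewrite coef_consr.
Qed.

Lemma update_update N (u : 'rV['F_2]_N) i a b :
  update (update u i a) i b = update u i b.
Proof. by apply/rowP => j; rewrite !mxE; case: eqP. Qed.

Lemma update_same N (u : 'rV['F_2]_N) i : update u i (u 0 i) = u.
Proof. by apply/rowP => j; rewrite !mxE; case: eqP => // ->. Qed.

(** Strings that differ at most at [i] are grouped; the representative of each group has entry 0 at
    [i]. *)
Lemma sum_update (V : nmodType) N (i : 'I_N) (f : 'rV['F_2]_N -> V) :
  \sum_u f u = \sum_(u : 'rV_N | u 0 i == 0) \sum_a f (update u i a).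
Proof.
rewrite exchange_big /= (partition_big (fun u : 'rV_N => u 0 i) predT) //=.
apply: eq_bigr => a _.
rewrite (reindex_onto (fun u => update u i a) (fun u => update u i 0)) /=.
  apply: eq_bigl => u; rewrite update_update mxE !eqxx /=.
  apply/eqP/eqP => [<-|u0]; first by rewrite mxE eqxx.
  by rewrite -u0 update_same.
by move=> u /eqP <-; rewrite update_update update_same.
Qed.

(** The projector on |0> is diagonal in the basis in which qubit [i] is measured, so each component
    is kept or killed. After factoring out the other qubits, this is [ketc_orth] at [i]. *)
Lemma coef_measure0 N (th z : 'rV['F_2]_N) i (psi : joint R m N) :
  coef th z (measure0 i (th 0 i) psi) = (z 0 i == 0)%:R *: coef th z psi.
Proof.
rewrite /coef (sum_update i) [X in _ = _ *: X](sum_update i) scaler_sumr.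
apply: eq_bigr => u _.
pose W := \prod_(j | j != i) ketc R (z 0 j) (th 0 j) (u 0 j).
have WE a : \prod_j ketc R (z 0 j) (th 0 j) (update u i a 0 j) =
    W * ketc R (z 0 i) (th 0 i) a.
  rewrite (bigD1 i) //= mxE eqxx mulrC; congr (_ * _).
  by apply: eq_bigr => j /negPf neq_ji; rewrite mxE neq_ji.
pose v := \sum_b ketc R 0 (th 0 i) b *: psi (update u i b).
have measE a : measure0 i (th 0 i) psi (update u i a) =
    ketc R 0 (th 0 i) a *: v.
  rewrite ffunE mxE eqxx scaler_sumr; apply: eq_bigr => b _.
  by rewrite mxE big_ord1 !mxE conj_ketc scalerA update_update.
under eq_bigr do rewrite WE measE scalerA -mulrA.
rewrite -scaler_suml -mulr_sumr ketc_orth.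
under [X in _ = _ *: X]eq_bigr do rewrite WE -scalerA.
rewrite -scaler_sumr scalerA.
by case: eqP => [->|_]; rewrite ?mulr1 ?mul1r // mulr0 mul0r !scale0r.
Qed.

End Coef.

(** * Rounds with adaptively chosen inputs *)

Section Adaptive.
Variables (R : realType) (m : nat).
Variable (K : seq ('F_2 * bool) -> 'F_2 -> 'M[R[i]]_m).

(* [h] is the history before the rounds listed in [s]. *)
Fixpoint kraus (h s : seq ('F_2 * bool)) : 'M[R[i]]_m :=
  if s is p :: s' then kraus (rcons h p) s' *m K h p.1 else 1%:M.

Definition transcript N (x : 'rV['F_2]_N) (v : 'I_N -> bool) :
    seq ('F_2 * bool) := [seq (x 0 i, v i) | i <- enum 'I_N].

Lemma transcript_consr N a x b (v : 'rV[bool]_N) :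
  transcript (consr a x) (fun i => consr b v 0 i) =
    (a, b) :: transcript x (fun i => v 0 i).
Proof.
rewrite /transcript enum_ordSl /= !consr0 -map_comp; congr (_ :: _).
by apply: eq_map => i /=; rewrite !consrS.
Qed.

(** Induction on the rounds, for an arbitrary history and state. Whatever the input [a] of the first
    round, a component [b] of its qubit gets the factor [w true b + w false b], at most [rho], once
    both check bits are summed. The operators act on the register only, so they commute with the
    splitting of qubits. *)
Lemma adaptive_sum_le (w : bool -> 'F_2 -> R) (rho : R) N h
    (psi : joint R m N) :
  (forall h, instrument (K h)) -> (forall t b, 0 <= w t b) ->
  (forall b, w true b + w false b <= rho) ->
  \sum_(x : 'rV['F_2]_N) \sum_(v : 'rV[bool]_N) \sum_(z : 'rV['F_2]_N)
      (\prod_i w (v 0 i) (z 0 i)) *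
      nsq (kraus h (transcript x (fun i => v 0 i)) *m coef x z psi)
    <= rho ^+ N * sqnorm psi.
Proof.
move=> instrK w_ge0 w_le; have rho_ge0 : 0 <= rho.
  by apply: le_trans (w_le 0); rewrite addr_ge0.
have sqnorm_ge0 M (phi : joint R m M) : 0 <= sqnorm phi.
  by rewrite sqnormE; apply: sumr_ge0 => z _; apply: nsq_ge0.
elim: N h psi => [|N IHN] h psi.
  rewrite -(sqnorm_coef 0) expr0 mul1r (bigD1 0) //= [X in _ + X]big1 ?addr0.
    rewrite (bigD1 (const_mx true)) //= [X in _ + X]big1 ?addr0.
      apply: ler_sum => z _; rewrite big_ord0 mul1r.
      by rewrite /transcript (size0nil (size_enum_ord 0)) mul1mx.
    by move=> u /negP[]; apply/eqP/rowP; case.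
  by move=> u /negP[]; apply/eqP/rowP; case.
rewrite sum_consr.
(* The mass is split by the outcome [a], then by the first qubit read in the basis [a]. The basis
   may depend on [a] because [sqnorm_part] holds for every basis. *)
have -> : rho ^+ N.+1 * sqnorm psi =
    \sum_a \sum_b rho * (rho ^+ N * sqnorm (part a b (act (K h a) psi))).
  rewrite -[in LHS](instrument_sqnorm psi (instrK h)) mulr_sumr.
  apply: eq_bigr => a _; rewrite -(sqnorm_part a) exprS mulr_sumr.
  by apply: eq_bigr => b _; rewrite mulrA.
apply: ler_sum => a _.
have -> : \sum_(x : 'rV['F_2]_N) \sum_(v : 'rV[bool]_N.+1)
      \sum_(z : 'rV['F_2]_N.+1) (\prod_i w (v 0 i) (z 0 i)) *
      nsq (kraus h (transcript (consr a x) (fun i => v 0 i)) *m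
        coef (consr a x) z psi) =
    \sum_b \sum_t w t b *
      \sum_(x : 'rV['F_2]_N) \sum_(v : 'rV[bool]_N) \sum_(z : 'rV['F_2]_N)
      (\prod_i w (v 0 i) (z 0 i)) *
      nsq (kraus (rcons h (a, t)) (transcript x (fun i => v 0 i)) *m
        coef x z (part a b (act (K h a) psi))).
  under eq_bigr => x _.
    rewrite sum_consr.
    under eq_bigr => t _.
      under eq_bigr => v _ do rewrite sum_consr.
      rewrite exchange_big /=; over.
    rewrite exchange_big /=; over.
  rewrite exchange_big /=; apply: eq_bigr => b _.
  rewrite exchange_big /=; apply: eq_bigr => t _.
  rewrite mulr_sumr; apply: eq_bigr => x _.
  rewrite mulr_sumr; apply: eq_bigr => v _.
  rewrite mulr_sumr; apply: eq_bigr => z _.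
  rewrite big_ord_recl !consr0 -mulrA; congr (_ * _); congr (_ * _).
    by apply: eq_bigr => i _; rewrite !consrS.
  by rewrite transcript_consr /= coef_consr -act_part coef_act mulmxA.
apply: ler_sum => b _; apply: le_trans (_ : _ <= \sum_t w t b *
    (rho ^+ N * sqnorm (part a b (act (K h a) psi)))) _.
  by apply: ler_sum => t _; apply: ler_wpM2l.
rewrite -mulr_suml big_bool; apply: ler_wpM2r; last exact: w_le.
by rewrite mulr_ge0 ?exprn_ge0.
Qed.

End Adaptive.


(** * The bases of all the measurements, checked and unveiled *)

Section Splice.
Variables (N : nat) (x : 'rV['F_2]_N) (t : {set 'I_N}).

Definition unchecked_part : 'rV['F_2]_#|~: t| := \row_j x 0 (enum_val j).

(** The bases in which all the qubits end up measured when [y] is announced; [pick] inverts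
    [enum_val] on the unchecked positions. *)
Definition splice (y : 'rV['F_2]_#|~: t|) : 'rV['F_2]_N :=
  \row_i (if [pick j | enum_val j == i] is Some j then y 0 j else x 0 i).

Lemma splice_checked y i : i \in t -> splice y 0 i = x 0 i.
Proof.
move=> it; rewrite mxE; case: pickP => // j /eqP def_i.
by have := enum_valP j; rewrite def_i inE it.
Qed.

Lemma splice_unchecked y j : splice y 0 (enum_val j) = y 0 j.
Proof.
rewrite mxE; case: pickP => [j' /eqP /enum_val_inj -> //|/(_ j)].
by rewrite eqxx.
Qed.

Lemma hamming_splice y : hamming (splice y) x = hamming y unchecked_part.
Proof.
rewrite /hamming -(card_imset _ (@enum_val_inj _ (mem (~: t)))).
apply: eq_card => i; rewrite inE; apply/idP/imsetP => [neq_i|[j]].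
  have it : i \in ~: t by rewrite inE; apply: contra neq_i => /splice_checked->.
  exists (enum_rank_in it i); last by rewrite enum_rankK_in.
  rewrite inE mxE -(splice_unchecked y) enum_rankK_in //.
by rewrite inE mxE => neq_j ->; rewrite splice_unchecked.
Qed.

End Splice.

(** * The final state of a run *)

Section Protocol.
Variables (R : realType) (N : nat) (tau r : R) (S : scheme N tau r).
Variable A : strategy S.
Local Notation C := R[i].

Lemma history_transcript (x : 'rV['F_2]_N) (t : {set 'I_N}) s1 i s2 :
  enum 'I_N = s1 ++ i :: s2 ->
  history x t i = [seq (x 0 j, j \in t) | j <- s1].
Proof.
move=> enumE; rewrite /history; congr map.
(* As natural numbers, the enumeration is [iota 0 N], so filtering by [j < i] yields exactly the
   prefix before [i]. *)
apply: (inj_map val_inj).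
have valE : map val (enum 'I_N) = iota 0 N by exact: val_enum_ord.
have ltsN : (size s1 <= N)%N.
  by rewrite -[X in (_ <= X)%N](size_enum_ord N) enumE size_cat leq_addr.
have valt : map val s1 = iota 0 (size s1).
  have -> : s1 = take (size s1) (enum 'I_N) by rewrite enumE take_size_cat.
  rewrite map_take valE take_iota size_take size_enum_ord.
  by case: ltngtP ltsN => // ->.
have i_val : nat_of_ord i = size s1.
  have : nth 0%N (map val (enum 'I_N)) (size s1) = i.
    by rewrite enumE map_cat nth_cat size_map ltnn subnn.
  rewrite valE nth_iota ?add0n => [<-//|].
  rewrite -[X in (_ < X)%N](size_enum_ord N) enumE size_cat /=.
  by rewrite addnS ltnS leq_addr.
rewrite valt -(filter_iota_ltn 0 ltsN) add0n -i_val -valE filter_map.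
by congr map; apply: eq_filter.
Qed.

(** Only checked positions are measured, and there [th] agrees with [x]; by [coef_measure0] each
    check contributes a 0/1 factor. Off [t] the basis [th] is free, which lets it follow the string
    announced later. *)
Lemma coef_rounds (x th z : 'rV['F_2]_N) (t : {set 'I_N}) s1 s2
    (psi : joint R (adim A) N) :
  enum 'I_N = s1 ++ s2 -> (forall i, i \in t -> th 0 i = x 0 i) ->
  coef th z (foldl (@round _ _ _ _ _ A x t) psi s2) =
    (all (fun i => (i \in t) ==> (z 0 i == 0)) s2)%:R *:
    (kraus (in_op A) [seq (x 0 j, j \in t) | j <- s1]
       [seq (x 0 j, j \in t) | j <- s2] *m coef th z psi).
Proof.
move=> + th_x; elim: s2 s1 psi => [|i s2 IHs2] s1 psi enumE /=.
  by rewrite scale1r mul1mx.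
rewrite (IHs2 (rcons s1 i)) ?cat_rcons // map_rcons -mulmxA.
have -> : coef th z (@round _ _ _ _ _ A x t psi i) =
    ((i \in t) ==> (z 0 i == 0))%:R *:
    (in_op A [seq (x 0 j, j \in t) | j <- s1] (x 0 i) *m coef th z psi).
  rewrite /round ffunE (history_transcript x t enumE) /=.
  case: ifP => it; last by rewrite coef_act scale1r.
  by rewrite -th_x // coef_measure0 coef_act.
by rewrite -scalemxAr scalerA -natrM mulnb andbC.
Qed.

Lemma coef_measures (t : {set 'I_N}) (y : 'rV['F_2]_#|~: t|) (th z : 'rV['F_2]_N)
    s (psi : joint R (adim A) N) :
  (forall j, th 0 (enum_val j) = y 0 j) ->
  coef th z (foldl (fun psi (j : 'I_#|~: t|) =>
      measure0 (enum_val j) (y 0 j) psi) psi s) =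
    (all (fun j : 'I_#|~: t| => z 0 (enum_val j) == 0) s)%:R *: coef th z psi.
Proof.
move=> th_y; elim: s psi => [|j s IHs] psi /=; first by rewrite scale1r.
by rewrite IHs -th_y coef_measure0 scalerA -natrM mulnb andbC.
Qed.

(** The checks and the unveiling together measure every qubit in the basis [th], so only the
    component 0 survives and Parseval's sum has one term. *)
Lemma sqnorm_after_reveal (I : info S) (y : 'rV['F_2]_#|~: checked I|) b :
  sqnorm (after_reveal A y b) =
  nsq (@open_op _ _ _ _ _ A I (y, b) *m
    (@com_op _ _ _ _ _ A (inputs I) (checked I) (code I)
       (fct I, synd I, masked I) *m
     (kraus (in_op A) [::] (transcript (inputs I) (fun i => i \in checked I)) *m
      coef (splice (inputs I) y) 0 (init A)))).
Proof.
set th := splice _ _.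
have coefE z : coef th z (after_reveal A y b) =
    (z == 0)%:R *: (@open_op _ _ _ _ _ A I (y, b) *m
    (@com_op _ _ _ _ _ A (inputs I) (checked I) (code I)
       (fct I, synd I, masked I) *m
     (kraus (in_op A) [::] (transcript (inputs I) (fun i => i \in checked I)) *m
      coef th z (init A)))).
  rewrite (coef_measures _ _ _ (splice_unchecked _ y)) !coef_act.
  rewrite (@coef_rounds (inputs I) _ _ _ [::]) //; last exact: splice_checked.
  rewrite -!scalemxAr scalerA -natrM mulnb; congr ((nat_of_bool _)%:R *: _).
  apply/andP/eqP => [[/allP z_un /allP z_ch]|->]; last first.
    by split; apply/allP => i _; rewrite mxE eqxx ?implybT.
  apply/rowP => i; rewrite mxE; have [it|it] := boolP (i \in checked I).
    by have := z_ch i; rewrite mem_enum it => /(_ isT)/eqP.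
  have it' : i \in ~: checked I by rewrite inE.
  have := z_un (enum_rank_in it' i).
  by rewrite mem_enum enum_rankK_in // => /(_ isT)/eqP.
rewrite -(sqnorm_coef th) (bigD1 0) //= big1 ?addr0.
  by rewrite coefE eqxx scale1r.
by move=> z /negPf z0; rewrite coefE z0 scale0r nsq0.
Qed.

End Protocol.


(** * Hamming distance and minimum distance of a code *)

Lemma hamming_sub n (x y : 'rV['F_2]_n) : hamming (x - y) 0 = hamming x y.
Proof. by apply: eq_card => i; rewrite !inE !mxE subr_eq0. Qed.

Lemma hamming_triangle n (x y z : 'rV['F_2]_n) :
  (hamming x z <= hamming x y + hamming y z)%N.
Proof.
apply: leq_trans (leq_card_setU _ _); apply/subset_leq_card/subsetP => i.
by rewrite !inE; case: (eqVneq (x 0 i) (y 0 i)) => // ->.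
Qed.

Lemma hammingC n (x y : 'rV['F_2]_n) : hamming x y = hamming y x.
Proof. by apply: eq_card => i; rewrite !inE eq_sym. Qed.

Lemma min_distance_le_size n (G : generator n) : (min_distance G <= n)%N.
Proof.
rewrite /min_distance; elim/big_rec: _ => // p d _ le_dn.
by rewrite geq_min le_dn orbT.
Qed.

Lemma min_distance_le n (G : generator n) v w :
  codeword G v -> codeword G w -> v != w -> (min_distance G <= hamming v w)%N.
Proof.
move=> Gv Gw neq_vw; rewrite /min_distance.
elim: index_enum (mem_index_enum (v, w)) => // p s IHs.
rewrite inE big_cons => /predU1P[<-|/IHs le_d].
  by rewrite Gv Gw neq_vw /= geq_minl.
by case: ifP => // _; apply: leq_trans (geq_minr _ _) le_d.
Qed.

(** * The extracted bit and the reduction to a weighted sum *)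

Section Extractor.
Variables (R : realType) (N : nat) (tau r : R) (S : scheme N tau r).

Definition nearby (I : info S) (v : 'rV['F_2]_#|~: checked I|) : bool :=
  (syndrome (parity S (code I)) v == synd I) &&
  (2 * hamming v (unchecked_part (inputs I) (checked I)) < min_distance (code I))%N.

(** The default 0 is harmless: when no string is [nearby], every accepted string is far, whichever
    bit it unveils. *)
Definition extractor (I : info S) : 'F_2 :=
  if [pick v | nearby (I := I) v] is Some v then hash (fct I) v + masked I
  else 0.

(** Two such strings have the same syndrome, so they differ by a codeword, of weight less than the
    minimum distance by the triangle inequality. *)
Lemma nearby_uniq (I : info S) v w :
  row_free (tagged (code I)) -> nearby (I := I) v -> nearby (I := I) w -> v = w.
Proof.
move=> freeG /andP[/eqP sv dv] /andP[/eqP sw dw]; apply/eqP.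
apply: contraT => neq_vw.
have: (min_distance (code I) <= hamming (v - w) 0)%N.
  apply: min_distance_le; rewrite ?subr_eq0 //.
    rewrite (parityP S freeG) /syndrome mulmxBl subr_eq0.
    by rewrite -!/(syndrome _ _) sv sw.
  by rewrite /codeword sub0mx.
rewrite hamming_sub => le_d.
have := hamming_triangle v (unchecked_part (inputs I) (checked I)) w.
rewrite (hammingC (unchecked_part _ _)); lia.
Qed.

(** A close accepted string would be the decoded one, so its hash would unveil the extracted bit and
    not the opposite. *)
Lemma accepts_far (I : info S) y b :
  row_free (tagged (code I)) -> accepts (I := I) y b -> b = 1 - extractor I ->
  (min_distance (code I) <=
     2 * hamming y (unchecked_part (inputs I) (checked I)))%N.
Proof.
move=> freeG /andP[sy /eqP <-] bE; rewrite leqNgt; apply/negP => near_y.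
have ny : nearby (I := I) y by rewrite /nearby sy.
move: bE; rewrite /extractor; case: pickP => [v|/(_ y)].
  move=> /(nearby_uniq freeG ny) <-.
  by case: (F2_cases (hash (fct I) y + masked I)) => ->.
by rewrite ny.
Qed.

(* [om t z] is what one unit of mass on |z>_x may contribute. *)
Lemma prob_unveil_opposite_le (A : strategy S) (q : R)
    (om : {set 'I_N} -> 'rV['F_2]_N -> R) :
  0 <= q <= 1 -> (forall t z, 0 <= om t z) ->
  (forall (t : {set 'I_N}) (x th : 'rV['F_2]_N),
     (forall i, i \in t -> th 0 i = x 0 i) ->
     tau * #|~: t|%:R <= 2 * (hamming th x)%:R ->
     let c (z : 'rV['F_2]_N) := \prod_i overlap R (th 0 i) (x 0 i) (z 0 i) in
     (forall z, om t z = 0 -> c z = 0) /\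
     \sum_z Normc.normc (c z) ^+ 2 / om t z <= 1) ->
  prob_unveil_opposite A q extractor <=
  \sum_(x : 'rV['F_2]_N) \sum_(t : {set 'I_N})
    (\prod_i (if i \in t then q else 1 - q)) *
    \sum_z om t z * nsq (kraus (in_op A) [::]
      (transcript x (fun i => i \in t)) *m coef x z (init A)).
Proof.
move=> /andP[q_ge0 q_le1] om_ge0 om_ok.
apply: ler_sum => x _; apply: ler_sum => t _; apply: ler_wpM2l.
  by apply: prodr_ge0 => i _; case: ifP; rewrite ?subr_ge0.
set V := (X in _ <= X).
(* The code probabilities sum to 1, so it suffices to bound the contribution of each code of
   positive probability; only those are known to be good. *)
rewrite -[V]mul1r -(choose_sum1 S t (bob_view x t)) mulr_suml.
apply: ler_sum => G _.
have [->|chooseG0] := eqVneq (Defs.choose S (bob_view x t) G) 0.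
  by rewrite !mul0r.
have chooseG : 0 < Defs.choose S (bob_view x t) G.
  by rewrite lt_def chooseG0 choose_ge0.
have /and3P[freeG _ distG] := choose_good chooseG.
apply: ler_wpM2l; first exact: ltW.
pose phi z := kraus (in_op A) [::] (transcript x (fun i => i \in t)) *m
  coef x z (init A).
(* The measurement that produces the message preserves total mass, so the bound splits over the
   messages and is proved for each one. The opening is treated likewise below. *)
have -> : V = \sum_g \sum_s \sum_w \sum_z om t z *
    nsq (@com_op _ _ _ _ _ A x t G (g, s, w) *m phi z).
  under [RHS]eq_bigr do under eq_bigr do rewrite exchange_big /=.
  under [RHS]eq_bigr do rewrite exchange_big /=.
  rewrite [RHS]exchange_big /=; apply: eq_bigr => z _.
  rewrite -(instrument_nsq _ (com_opP A x G)) mulr_sumr !pair_big /=.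
  by apply: eq_bigr => -[[g s] w] _.
apply: ler_sum => g _; apply: ler_sum => s _; apply: ler_sum => w _.
pose I := @Info _ _ _ _ S x t G g s w; rewrite -/I.
pose chi z := @com_op _ _ _ _ _ A x t G (g, s, w) *m phi z.
have -> : \sum_z om t z * nsq (chi z) = \sum_y \sum_b \sum_z om t z *
    nsq (@open_op _ _ _ _ _ A I (y, b) *m chi z).
  under [RHS]eq_bigr do rewrite exchange_big /=.
  rewrite [RHS]exchange_big /=; apply: eq_bigr => z _.
  rewrite -(instrument_nsq _ (open_opP A I)) mulr_sumr pair_big /=.
  by apply: eq_bigr => -[y b] _.
apply: ler_sum => y _; rewrite big_mkcond; apply: ler_sum => b _.
case: ifP => [/andP[acc /eqP bE]|_]; last first.
  by apply: sumr_ge0 => z _; rewrite mulr_ge0 ?nsq_ge0.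
have far_y := @accepts_far I y b freeG acc bE.
(* The surviving amplitude, expanded in the basis [x], is the sum to which [nsq_sum_le] applies. *)
rewrite sqnorm_after_reveal /= (coef_change _ x) !mulmx_sumr.
under [X in nsq X <= _]eq_bigr do rewrite -!scalemxAr.
have [] := om_ok t x (splice x y) (splice_checked _ _).
  rewrite hamming_splice -natrM; apply: le_trans distG _.
  by rewrite ler_nat.
by move=> om0 om_le1; apply: nsq_sum_le.
Qed.

End Extractor.


(** * Numerical inequalities *)

Section RealBounds.
Variable R : realType.

Lemma ln2_gt0 : 0 < ln (2 : R).
Proof. by rewrite ln_gt0 // ltr1n. Qed.

Lemma powR2E (a : R) : 2 `^ a = expR (a * ln 2).
Proof. by rewrite /powR pnatr_eq0. Qed.

Lemma entropy_ln2 (delta : R) :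
  entropy delta * ln 2 = - (delta * ln delta + (1 - delta) * ln (1 - delta)).
Proof. by rewrite /entropy /log2; field; rewrite gt_eqF // ln2_gt0. Qed.

Lemma entropy_ge0 (delta : R) : 0 < delta < 1 -> 0 <= entropy delta.
Proof.
move=> /andP[d0 d1]; rewrite -(pmulr_lge0 _ ln2_gt0) entropy_ln2 oppr_ge0.
by rewrite ler_wnDr // pmulr_rle0 ?ln_le0 ?subr_gt0 //; lra.
Qed.

(** Put [u = 2 ^ (-g)]. From [2 ^ (2qg) >= 1 + 2qg ln 2] and [g ln 2 >= 1 - u], the right side
    exceeds the left by at least [q (1 - u) (2u - 1)], which is nonnegative because [g <= 1] gives
    [u >= 1/2]. *)
Lemma powR2_mix_le (q g : R) : 0 <= q -> 0 <= g <= 1 ->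
  q + (1 - q) * 2 `^ (- g) <= 2 `^ (- ((1 - 2 * q) * g)).
Proof.
move=> q_ge0 /andP[g_ge0 g_le1].
have u_ge : 2^-1 <= 2 `^ (- g).
  by rewrite -[X in X <= _](@powR_inv1 R) ?ler_powR ?ler1n ?lerN2.
have u_le1 : 2 `^ (- g) <= 1.
  by rewrite -[X in _ <= X](powRr0 2) ler_powR ?ler1n ?oppr_le0.
have l_ge : 1 - 2 `^ (- g) <= g * ln 2.
  by have := expR_ge1Dx (- g * ln 2); rewrite -powR2E; lra.
have -> : - ((1 - 2 * q) * g) = - g + 2 * q * g by ring.
rewrite powRD ?pnatr_eq0 ?implybT //.
have := expR_ge1Dx (2 * q * g * ln 2); rewrite -powR2E.
move: (2 `^ (- g)) u_ge u_le1 l_ge (2 `^ _) => u u_ge u_le1 l_ge e e_ge.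
have : u * (1 + 2 * q * (1 - u)) <= u * e.
  apply: ler_wpM2l; first lra.
  apply: le_trans e_ge; rewrite lerD2l -!mulrA ler_wpM2l ?ler_wpM2l //.
by have : 0 <= q * (1 - u) * (2 * u - 1); [rewrite !mulr_ge0; lra|nra].
Qed.

(* The next two bounds are the conditional expectations of the supermartingale
   [exp (q * (errors - delta * unchecked))] (killed when an error is detected),
   for a position with, resp. without, an error. *)
Lemma mgf_error_le (q delta : R) :
  0 < q -> q <= 1 / 2 -> 0 < delta -> delta <= 1 / 2 ->
  (1 - q) * expR (q * (1 - delta)) <= expR (- (q ^+ 2 * delta ^+ 2 / 4)).
Proof.
move=> q_gt0 q_le d_gt0 d_le.
apply: (@le_trans _ _ (expR (- q) * expR (q * (1 - delta)))).
  by rewrite ler_wpM2r ?expR_ge0 // expR_ge1Dx.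
rewrite -expRD ler_expR.
have : 0 < q * delta by rewrite mulr_gt0.
have : q * delta <= 1 by nra.
nra.
Qed.

Lemma mgf_no_error_le (q delta : R) :
  0 < q -> q <= 1 / 2 -> 0 < delta -> delta <= 1 / 2 ->
  q + (1 - q) * expR (- (q * delta)) <= expR (- (q ^+ 2 * delta ^+ 2 / 4)).
Proof.
move=> q_gt0 q_le d_gt0 d_le; apply: le_trans (expR_ge1Dx _).
set p := q * delta; have p_gt0 : 0 < p by rewrite mulr_gt0.
have p_le : p <= 1 / 4 by rewrite /p; nra.
(* As [exp(-p) <= 1/(1 + p) <= 1 - p/2] and [q <= 1/2], the left side is at most [1 - p/4], and
   [p ^ 2 <= p]. *)
have e_le : expR (- p) <= (1 + p)^-1.
  by rewrite expRN lef_pV2 ?posrE ?expR_gt0 ?expR_ge1Dx //; lra.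
have : (1 + p)^-1 <= 1 - p / 2.
  by rewrite -[_^-1]mul1r ler_pdivrMr; nra.
have -> : q ^+ 2 * delta ^+ 2 = p ^+ 2 by rewrite exprMn.
nra.
Qed.

End RealBounds.

(** * Light and heavy components and their weights *)

Section Weights.
Variables (R : realType) (N : nat).
Implicit Types (t : {set 'I_N}) (x z th : 'rV['F_2]_N).

Definition undetected t z : bool := [forall i in t, z 0 i == 0].

Lemma sum_card (A : {set 'I_N}) : \sum_i ((i \in A)%:R : R) = #|A|%:R.
Proof.
by rewrite -sum1_card natr_sum [RHS]big_mkcond; apply: eq_bigr => i _; case: ifP.
Qed.

Lemma sum_unchecked t z (a b : R) : undetected t z ->
  \sum_i (if i \in t then 0 else if z 0 i == 0 then a else b) =
  #|~: t|%:R * a + (hamming z 0)%:R * (b - a).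
Proof.
move=> /forall_inP z_t; rewrite -!sum_card !mulr_suml -big_split.
apply: eq_bigr => i _; rewrite !inE mxE; case: ifP => [/z_t -> |_] /=.
  by rewrite !mul0r addr0.
by case: eqP => _ /=; ring.
Qed.

(** Entropy bound on a Hamming ball: under the product distribution [F], with bias [delta] off [t]
    and entry 0 on [t], every counted string has probability at least [2 ^ (- n h(delta))]. Since
    [delta <= 1/2], the probability decreases with the weight. *)
Lemma card_light_le (delta : R) t : 0 < delta -> delta <= 1 / 2 ->
  #|[set z | undetected t z & (hamming z 0)%:R <= delta * #|~: t|%:R]|%:R <=
    2 `^ (#|~: t|%:R * entropy delta) :> R.
Proof.
move=> d_gt0 d_le; set B := [set z | _]; set n : R := #|~: t|%:R.
pose F (i : 'I_N) (b : 'F_2) : R :=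
  if i \in t then (b == 0)%:R else if b == 0 then 1 - delta else delta.
have F_ge0 i b : 0 <= F i b.
  by rewrite /F; case: ifP => _ //; case: ifP => _; lra.
have sumF : \sum_(z : 'rV['F_2]_N) \prod_i F i (z 0 i) = 1.
  rewrite -prod_sum_row big1 // => i _.
  by rewrite sum_F2 /F eqxx oner_eq0; case: ifP => _; rewrite ?addr0 ?subrK.
have BF z : z \in B -> 2 `^ (- (n * entropy delta)) <= \prod_i F i (z 0 i).
  rewrite inE => /andP[z_t light_z].
  have -> : \prod_i F i (z 0 i) = expR (\sum_i (if i \in t then 0
      else if z 0 i == 0 then ln (1 - delta) else ln delta)).
    rewrite expR_sum; apply: eq_bigr => i _; rewrite /F; case: ifP => it.
      by rewrite (forall_inP z_t i it) expR0.
    by case: ifP => _; rewrite lnK // posrE; lra.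
  rewrite sum_unchecked // powR2E ler_expR -/n.
  rewrite mulNr -mulrA entropy_ln2.
  have : ln delta <= ln (1 - delta) by rewrite ler_ln ?posrE; lra.
  rewrite -subr_ge0 => ln_le; rewrite -subr_ge0 in light_z.
  by have := mulr_ge0 light_z ln_le; rewrite -/n; nra.
rewrite -[leRHS]mul1r -ler_pdivrMr ?powR_gt0 // -powRN -[leRHS]sumF.
apply: (@le_trans _ _ (\sum_(z in B) \prod_i F i (z 0 i))); last first.
  rewrite [leRHS](bigID (mem B)) /= lerDl sumr_ge0 // => z _.
  exact: prodr_ge0.
by rewrite -sum1_card natr_sum mulr_suml; apply: ler_sum => z /BF; rewrite mul1r.
Qed.

Let amp th x z := \prod_i overlap R (th 0 i) (x 0 i) (z 0 i).

Lemma normc_amp th x z : Normc.normc (amp th x z) ^+ 2 =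
  \prod_i Normc.normc (overlap R (th 0 i) (x 0 i) (z 0 i)) ^+ 2.
Proof.
rewrite /amp; elim/big_ind2: _ => [|a b c d <- <-|//].
  by rewrite Normc.normc1 expr1n.
by rewrite Normc.normcM exprMn.
Qed.

Lemma sum_normc_amp th x : \sum_z Normc.normc (amp th x z) ^+ 2 = 1.
Proof.
under eq_bigr do rewrite normc_amp.
rewrite -(prod_sum_row (fun i b =>
  Normc.normc (overlap R (th 0 i) (x 0 i) b) ^+ 2)).
by rewrite big1 // => i _; rewrite sum_overlap.
Qed.

(** Each position where the bases differ contributes exactly 1/2, every other one at most 1. *)
Lemma normc_amp_le th x z :
  Normc.normc (amp th x z) ^+ 2 <= 2 `^ (- (hamming th x)%:R).
Proof.
rewrite normc_amp powRN powR_mulrn // -exprVn /hamming -prodr_const.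
rewrite [leRHS]big_mkcond; apply: ler_prod => i _; rewrite sqr_ge0 inE /=.
case: (eqVneq (th 0 i) (x 0 i)) => [->|/overlap_neq-> //] /=.
rewrite overlap_same; case: eqP => _; last by rewrite normc_zero expr0n.
by rewrite Normc.normc1 expr1n.
Qed.

Lemma amp_detected t th x z :
  (forall i, i \in t -> th 0 i = x 0 i) -> ~~ undetected t z -> amp th x z = 0.
Proof.
move=> th_x; rewrite negb_forall_in => /exists_inP[i it /negPf zi].
by rewrite /amp (bigD1 i) //= th_x // overlap_same zi mul0r.
Qed.

(* The weights for [nsq_sum_le]: at given [t], the light components share
   a fraction [1 / (1 + eta)] of the unit budget, and the heavy ones share
   the rest. *)
Definition weight (delta eta u : R) t z : R :=
  if undetected t z then
    if (hamming z 0)%:R <= delta * #|~: t|%:R then (1 + eta) * u ^+ #|~: t|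
    else 1 + eta^-1
  else 0.

(** Light components: their number times their largest squared amplitude is at most
    [2 ^ (n h - n tau / 2)], which is at most [u ^+ n] as [h >= 0]. Heavy components: their total
    squared amplitude is at most 1, by Parseval. *)
Lemma sum_amp_weight_le (delta eta tau : R) t th x :
  0 < delta -> delta <= 1 / 2 -> 0 < eta ->
  (forall i, i \in t -> th 0 i = x 0 i) ->
  tau * #|~: t|%:R <= 2 * (hamming th x)%:R ->
  \sum_z Normc.normc (amp th x z) ^+ 2 /
    weight delta eta (2 `^ (- (tau / 2 - 2 * entropy delta))) t z <= 1.
Proof.
move=> d_gt0 d_le eta_gt0 th_x far; set u := 2 `^ _.
have u_gt0 : 0 < u by rewrite powR_gt0.
set n := #|~: t|; set B := [set z | undetected t z &
  (hamming z 0)%:R <= delta * #|~: t|%:R].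
have un_gt0 : 0 < u ^+ n by rewrite exprn_gt0.
have eta1 : 0 < 1 + eta by lra.
have -> : 1 = (1 + eta)^-1 + eta / (1 + eta).
  by field; rewrite gt_eqF.
apply: (@le_trans _ _ (\sum_z
    ((if z \in B then 2 `^ (- (hamming th x)%:R) / ((1 + eta) * u ^+ n) else 0) +
     Normc.normc (amp th x z) ^+ 2 * (eta / (1 + eta))))).
  apply: ler_sum => z _; rewrite /weight inE.
  have bad_ge0 : 0 <= Normc.normc (amp th x z) ^+ 2 * (eta / (1 + eta)).
    by rewrite mulr_ge0 ?sqr_ge0 // divr_ge0 // ltW.
  case: ifP => /= [_|/negbT/(amp_detected th_x)->]; last first.
    by rewrite normc_zero expr0n !mul0r addr0.
  case: ifP => _; last first.
    rewrite add0r; have -> // : (1 + eta^-1)^-1 = eta / (1 + eta).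
    by field; rewrite !gt_eqF.
  rewrite ler_wpDr // ler_wpM2r ?normc_amp_le // invr_ge0 mulr_ge0 // ltW //.
rewrite big_split -mulr_suml sum_normc_amp mul1r /= lerD2r.
rewrite -big_mkcond sumr_const -[leLHS]mulr_natr mulrAC.
rewrite ler_pdivrMr ?mulr_gt0 // mulKf ?gt_eqF // mulrC.
apply: (@le_trans _ _ (2 `^ (#|~: t|%:R * entropy delta) *
    2 `^ (- (hamming th x)%:R))).
  by rewrite ler_wpM2r ?powR_ge0 // card_light_le.
rewrite -powRD ?pnatr_eq0 ?implybT // /u -powR_mulrn ?powR_ge0 // -powRrM.
apply: ler_powR; rewrite ?ler1n //.
have : 0 <= entropy delta by apply: entropy_ge0; lra.
by move: far; rewrite -/n; have := ler0n R n; nra.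
Qed.

Lemma sum_set_row (V : nmodType) (f : {set 'I_N} -> V) :
  \sum_t f t = \sum_(v : 'rV[bool]_N) f [set i | v 0 i].
Proof.
rewrite (reindex (fun v : 'rV[bool]_N => [set i | v 0 i])) //.
exists (fun t : {set 'I_N} => \row_i (i \in t)) => [v|t] _.
  by apply/rowP => i; rewrite mxE inE.
by apply/setP => i; rewrite inE mxE.
Qed.

Lemma adaptive_sum_set_le m (K : seq ('F_2 * bool) -> 'F_2 -> 'M[R[i]]_m)
    (w : bool -> 'F_2 -> R) (rho : R) (psi : joint R m N) :
  (forall h, instrument (K h)) -> (forall (c : bool) b, 0 <= w c b) ->
  (forall b, w true b + w false b <= rho) ->
  \sum_(x : 'rV['F_2]_N) \sum_(t : {set 'I_N}) \sum_(z : 'rV['F_2]_N)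
      (\prod_i w (i \in t) (z 0 i)) *
      nsq (kraus K [::] (transcript x (fun i => i \in t)) *m coef x z psi)
    <= rho ^+ N * sqnorm psi.
Proof.
move=> instrK w_ge0 w_le.
apply: le_trans (adaptive_sum_le [::] psi instrK w_ge0 w_le).
apply: ler_sum => x _; rewrite sum_set_row; apply: ler_sum => v _.
apply: ler_sum => z _; rewrite le_eqVlt; apply/orP; left; apply/eqP.
congr (_ * nsq (kraus K [::] _ *m _)).
  by apply: eq_bigr => i _; rewrite inE.
by apply: eq_map => i; rewrite inE.
Qed.

(** Both parts of the weight are bounded by products over positions, as [adaptive_sum_set_le]
    requires. The heavy case is Markov's exponential trick: its indicator is at most
    [exp(q (hamming z 0 - delta n))], and [undetected] is a product of one-position indicators. *)
Lemma weight_le (q delta eta u : R) t z :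
  0 <= q <= 1 -> 0 < eta -> 0 < u ->
  (\prod_i (if i \in t then q else 1 - q)) * weight delta eta u t z <=
  (1 + eta) * \prod_i (if i \in t then q else (1 - q) * u) +
  (1 + eta^-1) * \prod_i (if i \in t then q * (z 0 i == 0)%:R
     else (1 - q) * (if z 0 i == 0 then expR (- (q * delta))
                     else expR (q * (1 - delta)))).
Proof.
move=> /andP[q_ge0 q_le1] eta_gt0 u_gt0; rewrite /weight.
have goodE : \prod_i (if i \in t then q else (1 - q) * u) =
    (\prod_i (if i \in t then q else 1 - q)) * u ^+ #|~: t|.
  rewrite -prodr_const [X in _ = _ * X]big_mkcond -big_split /=.
  by apply: eq_bigr => i _; rewrite inE; case: ifP => _ /=; rewrite ?mulr1.
set P := \prod_i (if i \in t then q else 1 - q) in goodE *.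
have P_ge0 : 0 <= P by apply: prodr_ge0 => i _; case: ifP; rewrite ?subr_ge0.
set Q := \prod_i (if i \in t then q * _ else _).
have Q_ge0 : 0 <= Q.
  apply: prodr_ge0 => i _; case: ifP => _; first by rewrite mulr_ge0.
  by rewrite mulr_ge0 ?subr_ge0 //; case: ifP; rewrite expR_ge0.
have etaV : 0 < eta^-1 by rewrite invr_gt0.
have good_ge0 : 0 <= (1 + eta) * (P * u ^+ #|~: t|).
  by rewrite !mulr_ge0 ?exprn_ge0 //; lra.
have bad_ge0 : 0 <= (1 + eta^-1) * Q by rewrite mulr_ge0 //; lra.
rewrite goodE; case: ifP => [z_t|_]; last by rewrite mulr0 addr_ge0.
case: (leP (hamming z 0)%:R (delta * _)) => [_|heavy].
  by rewrite mulrCA lerDl.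
rewrite mulrC; apply: le_trans (_ : (1 + eta^-1) * Q <= _); last by rewrite lerDr.
apply: ler_wpM2l; first lra.
have -> : Q = P * expR (\sum_i (if i \in t then 0
    else if z 0 i == 0 then - (q * delta) else q * (1 - delta))).
  rewrite expR_sum -big_split; apply: eq_bigr => i _ /=; case: ifP => it.
    by rewrite (forall_inP z_t i it) expR0.
  by case: ifP.
rewrite sum_unchecked // ler_peMr // -[leLHS]expR0 ler_expR.
have -> : q * (1 - delta) - - (q * delta) = q by ring.
have -> : #|~: t|%:R * - (q * delta) + (hamming z 0)%:R * q =
  q * ((hamming z 0)%:R - delta * #|~: t|%:R) by ring.
by rewrite mulr_ge0 // subr_ge0 ltW.
Qed.

End Weights.


(** * Bounds on the probability of unveiling the opposite bit *)

Section Bounds.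
Variables (R : realType) (N : nat) (tau r : R) (S : scheme N tau r).
Variable A : strategy S.

(** Since [choose] is a distribution, some code has positive probability. With nothing checked, its
    length is [N > 0] and its distance at most [N]. *)
Lemma tau_le1 : (0 < N)%N -> tau <= 1.
Proof.
move=> N_gt0; pose v := bob_view (0 : 'rV_N) set0.
have [G chooseG|choose0] := pickP (fun G : generator #|~: (set0 : {set 'I_N})| =>
  0 < Defs.choose S v G); last first.
  have := choose_sum1 S set0 v; rewrite big1 => [/eqP|G _].
    by rewrite eq_sym oner_eq0.
  by apply/eqP; rewrite eq_le choose_ge0 leNgt choose0.
have /and3P[_ _ distG] := choose_good chooseG.
have card_gt0 : 0 < #|~: (set0 : {set 'I_N})|%:R :> R.
  by rewrite setC0 cardsT card_ord ltr0n.
rewrite -(ler_pM2r card_gt0) mul1r; apply: le_trans distG _.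
by rewrite ler_nat min_distance_le_size.
Qed.

(** The constant weight 1 gives the plain Cauchy-Schwarz inequality. This settles the cases where
    the claimed bound is at least 1. *)
Lemma prob_unveil_opposite_le1 (q : R) :
  0 <= q <= 1 -> prob_unveil_opposite A q (@extractor _ _ _ _ S) <= 1.
Proof.
move=> q01; have /andP[q_ge0 q_le1] := q01.
apply: (le_trans (@prob_unveil_opposite_le _ _ _ _ S A q (fun _ _ => 1) q01 _ _)).
- by [].
- move=> t x th _ _; split=> [z /eqP|]; first by rewrite oner_eq0.
  by under eq_bigr do rewrite divr1; rewrite sum_normc_amp.
pose w (c : bool) (_ : 'F_2) : R := if c then q else 1 - q.
have w_ge0 c b : 0 <= w c b by case: c; rewrite /w ?subr_ge0.
have w_le b : w true b + w false b <= 1 by rewrite /w addrC subrK.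
have := adaptive_sum_set_le (init A) (in_opP A) w_ge0 w_le.
rewrite init_unit expr1n mulr1; apply: le_trans.
apply: ler_sum => x _; apply: ler_sum => t _; rewrite mulr_sumr.
by apply: ler_sum => z _; rewrite mul1r.
Qed.

Lemma prob_unveil_opposite_le_mix (q delta eta : R) :
  0 < q -> q <= 1 / 2 -> 0 < delta -> delta <= 1 / 2 -> 0 < eta ->
  prob_unveil_opposite A q (@extractor _ _ _ _ S) <=
  (1 + eta) * (q + (1 - q) * 2 `^ (- (tau / 2 - 2 * entropy delta))) ^+ N +
  (1 + eta^-1) * expR (- (q ^+ 2 * delta ^+ 2 / 4)) ^+ N.
Proof.
move=> q_gt0 q_le d_gt0 d_le eta_gt0; set u := 2 `^ _.
have q01 : 0 <= q <= 1 by lra.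
have u_gt0 : 0 < u by rewrite powR_gt0.
have etaV : 0 < eta^-1 by rewrite invr_gt0.
have weight_ge0 (t : {set 'I_N}) z : 0 <= weight delta eta u t z.
  rewrite /weight; case: ifP => // _; case: ifP => _; last lra.
  by rewrite mulr_ge0 ?exprn_ge0 //; lra.
apply: (le_trans (@prob_unveil_opposite_le _ _ _ _ S A q _ q01 weight_ge0 _)).
  move=> t x th th_x far; split; last exact: sum_amp_weight_le.
  move=> z /eqP; rewrite /weight; case: ifP => [_|/negbT/(amp_detected R th_x)//].
  have un_gt0 : 0 < u ^+ #|~: t| by rewrite exprn_gt0.
  by case: ifP => _; rewrite gt_eqF // ?mulr_gt0 //; lra.
(* The factors per round: averaging [good] over the check bit gives [q + (1 - q) u], and averaging
   [bad] gives the two bounds on the supermartingale. *)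
pose good (c : bool) (_ : 'F_2) : R := if c then q else (1 - q) * u.
pose bad (c : bool) (b : 'F_2) : R := if c then q * (b == 0)%:R
  else (1 - q) * (if b == 0 then expR (- (q * delta))
                  else expR (q * (1 - delta))).
pose V x (t : {set 'I_N}) z := nsq (kraus (in_op A) [::]
  (transcript x (fun i => i \in t)) *m coef x z (init A)).
apply: (@le_trans _ _
  ((1 + eta) * (\sum_(x : 'rV['F_2]_N) \sum_(t : {set 'I_N})
     \sum_(z : 'rV['F_2]_N) (\prod_i good (i \in t) (z 0 i)) * V x t z) +
   (1 + eta^-1) * (\sum_(x : 'rV['F_2]_N) \sum_(t : {set 'I_N})
     \sum_(z : 'rV['F_2]_N) (\prod_i bad (i \in t) (z 0 i)) * V x t z))).
  rewrite !mulr_sumr -big_split; apply: ler_sum => x _ /=.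
  rewrite !mulr_sumr -big_split; apply: ler_sum => t _ /=.
  rewrite !mulr_sumr -big_split; apply: ler_sum => z _ /=.
  rewrite !mulrA -mulrDl ler_wpM2r ?nsq_ge0 //.
  exact: weight_le.
have mix (w : bool -> 'F_2 -> R) rho : (forall c b, 0 <= w c b) ->
    (forall b, w true b + w false b <= rho) ->
    \sum_(x : 'rV['F_2]_N) \sum_(t : {set 'I_N}) \sum_(z : 'rV['F_2]_N)
      (\prod_i w (i \in t) (z 0 i)) * V x t z <= rho ^+ N.
  move=> w_ge0 w_le; have := adaptive_sum_set_le (init A) (in_opP A) w_ge0 w_le.
  by rewrite init_unit mulr1.
apply: lerD; (apply: ler_wpM2l; first lra); apply: mix.
- by case=> b; rewrite /good; rewrite ?mulr_ge0 //; lra.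
- by [].
- case=> b; rewrite /bad; first by rewrite mulr_ge0 //; lra.
  by rewrite mulr_ge0 //; [lra|case: ifP; rewrite expR_ge0].
- move=> b; rewrite /bad; case: (b == 0).
    by rewrite mulr1 mgf_no_error_le.
  by rewrite mulr0 add0r mgf_error_le.
Qed.

End Bounds.

Theorem theorem4 (R : realType) (N : nat) (q tau r : R)
    (S : scheme N tau r) (delta : R) :
  0 < q -> q <= 1 / 2 -> 0 < tau -> r < 1 ->
  0 < delta -> delta <= 1 / 2 ->
  exists2 eps : R,
    universally_extractable q S eps &
    eps <= 2 `^ (- (N%:R * (1 - 2 * q) * (tau / 2 - 2 * entropy delta)))
           + Num.sqrt (4 * expR (- (q ^+ 2 * delta ^+ 2 * N%:R / 8))).
Proof.
move=> q_gt0 q_le _ _ d_gt0 d_le; eexists; last exact: lexx.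
exists (@extractor _ _ _ _ S) => A.
set g := tau / 2 - 2 * entropy delta; set F := 2 `^ _.
(* With the constant 16, the square root is [2 * E] and the bound on the heavy mass is [E ^+ 4]. *)
pose E := expR (- (q ^+ 2 * delta ^+ 2 * N%:R / 16)).
have E_gt0 : 0 < E by apply: expR_gt0.
have -> : Num.sqrt (4 * expR (- (q ^+ 2 * delta ^+ 2 * N%:R / 8))) = 2 * E.
  have -> : 4 * expR (- (q ^+ 2 * delta ^+ 2 * N%:R / 8)) = (2 * E) ^+ 2.
    rewrite exprMn -expRM_natl; congr (_ * expR _); first by ring.
    by field.
  by rewrite sqrtr_sqr ger0_norm // mulr_ge0 // ltW.
have F_ge0 : 0 <= F by apply: powR_ge0.
have q01 : 0 <= q <= 1 by lra.
have prob_le1 := prob_unveil_opposite_le1 A q01.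
(* If [F >= 1] or [E >= 1/2], the claimed bound is at least 1. Otherwise [F < 1] forces [N > 0] and
   a positive exponent [g]. *)
have [F_ge1|F_lt1] := leP 1 F; first by apply: le_trans prob_le1 _; lra.
have [E_ge|E_lt] := leP (1 / 2) E; first by apply: le_trans prob_le1 _; lra.
have N_gt0 : (0 < N)%N.
  rewrite lt0n; apply: contraTneq F_lt1 => N0.
  by rewrite -leNgt /F N0 !mul0r oppr0 powRr0.
have g_gt0 : 0 < g.
  rewrite ltNge; apply: contraTN F_lt1 => g_le0.
  rewrite -leNgt -[leLHS](powRr0 2) ler_powR ?ler1n // oppr_ge0.
  by rewrite mulr_ge0_le0 // mulr_ge0 //; lra.
have g_le1 : g <= 1.
  have := tau_le1 S N_gt0.
  by have : 0 <= entropy delta by [apply: entropy_ge0; lra]; rewrite /g; lra.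
(* The choice [eta = E] gives [(1 + E) F + E ^ 4 + E ^ 3]; the terms beyond [F] are at most
   [E + E/4 + E/4], within the available [2 * E]. *)
have := prob_unveil_opposite_le_mix A q_gt0 q_le d_gt0 d_le E_gt0.
rewrite -/g => /le_trans; apply.
have mix_le : (q + (1 - q) * 2 `^ (- g)) ^+ N <= F.
  have -> : F = (2 `^ (- ((1 - 2 * q) * g))) ^+ N.
    rewrite -powR_mulrn ?powR_ge0 // -powRrM; congr (_ `^ _); ring.
  apply: lerXn2r; rewrite ?nnegrE ?powR_ge0 //.
    by rewrite addr_ge0 ?mulr_ge0 ?powR_ge0 //; lra.
  by apply: powR2_mix_le; lra.
have rhoE : expR (- (q ^+ 2 * delta ^+ 2 / 4)) ^+ N = E ^+ 4.
  by rewrite -!expRM_natl; congr expR; field.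
rewrite rhoE.
have -> : (1 + E^-1) * E ^+ 4 = E ^+ 4 + E ^+ 3.
  by field; rewrite gt_eqF.
have : (1 + E) * (q + (1 - q) * 2 `^ (- g)) ^+ N <= (1 + E) * F.
  by apply: ler_wpM2l => //; lra.
have : E * F <= E by rewrite ler_piMr // ltW.
have E2_le : E ^+ 2 <= 1 / 4 by nra.
have : E ^+ 3 <= E * (1 / 4) by rewrite exprS ler_wpM2l // ltW.
have : E ^+ 4 <= E * (1 / 4).
  by rewrite exprS ler_wpM2l ?exprS ?(ltW E_gt0) //; nra.
lra.
Qed.
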